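(* Let ${\mathfrak D}$ be an unbounded LMI region with characteristics $\theta_0>0$ and $x_{max}<+\infty$. Let a real $n\times n$ matrix ${\mathbf A}$ be diagonally ${\mathbb C}^{\alpha}_{\theta}$-dominant with $0<\theta\le\theta_0$ and $\alpha\le\min(0,x_{max})$. Then ${\mathbf A}$ is ${\mathfrak D}$-stable and, moreover, $({\mathfrak D},D)$-stable.
   Context: An LMI region is a (nonempty) set ${\mathfrak D}=\{z\in{\mathbb C}: {\mathbf L}+z{\mathbf M}+\overline{z}{\mathbf M}^T\prec 0\}$ (negative definite), where ${\mathbf L},{\mathbf M}$ are real square matrices of the same size and ${\mathbf L}^T={\mathbf L}$. It is open and convex; $\overline{\mathfrak D}$ denotes its closure. The recession cone ${\mathfrak D}_{rc}$ of an unbounded ${\mathfrak D}$ is the cone of directions $w$ such that $z+tw\in{\mathfrak D}$ for all $z\in{\mathfrak D}$, $t\ge0$. The regions considered are those whose recession cone is a closed convex conic sector around the negative direction of the real axis with apex at the origin; its inner angle is $2\theta_0$, i.e. $\theta_0\in[0,\pi/2]$ is the angle between the negative real axis and the bounding ray (so $\theta_0=\pi/2$ means ${\mathfrak D}_{rc}$ is the closed left half-plane). $x_{max}=\sup({\mathfrak D}\cap{\mathbb R})$. A real matrix ${\mathbf A}=\{a_{ij}\}$ is diagonally ${\mathbb C}^{\alpha}_{\theta}$-dominant (for $\theta\in(0,\pi/2]$, $\alpha\in{\mathbb R}$) if $a_{ii}<\alpha$ and $\sin\theta\,|a_{ii}-\alpha|>\sum_{j\ne i}|a_{ij}|$ for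 all $i$. ${\mathbf A}$ is ${\mathfrak D}$-stable if $\sigma({\mathbf A})\subset{\mathfrak D}$. ${\mathbf A}$ is $({\mathfrak D},D)$-stable if: in the case $0\in\overline{\mathfrak D}$, $\sigma({\mathbf D}{\mathbf A})\subset{\mathfrak D}$ for every diagonal ${\mathbf D}$ with positive diagonal entries; in the case $0\in{\mathbb C}\setminus\overline{\mathfrak D}$, $\sigma({\mathbf D}{\mathbf A})\subset{\mathfrak D}$ for every diagonal ${\mathbf D}$ with all diagonal entries $d_{ii}\ge1$. *)

(* Defs.v *)
From HB Require Import structures.
From mathcomp Require Import all_boot all_order all_algebra.
From mathcomp Require Import all_classical all_reals all_analysis.
From mathcomp Require Export complex.

Set Implicit Arguments.
Unset Strict Implicit.
Unset Printing Implicit Defensive.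

Import Order.TTheory GRing.Theory Num.Theory.
Import numFieldNormedType.Exports.

Local Open Scope classical_set_scope.
Local Open Scope ring_scope.

Section LMIRegions.
Variable R : realType.
Local Notation C := (complex R).
Local Notation "x %:C" := (real_complex R x).

Definition complex_mx m n (A : 'M[R]_(m, n)) : 'M[C]_(m, n) :=
  map_mx (real_complex R) A.

(** The order of [complex R] is partial: [w < 0] says that [w] is real and
    negative. *)
Definition negative_definite m (W : 'M[C]_m) : Prop :=
  forall v : 'cV[C]_m, v != 0 -> (map_mx Num.conj v^T *m W *m v) 0 0 < 0.

Definition LMI_set m (L M : 'M[R]_m) : set C :=
  [set z | negative_definite
             (complex_mx L + z *: complex_mx M
              + Num.conj z *: complex_mx M^T)].

Definition LMI_region (D : set C) : Prop :=
  D !=set0 /\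
  exists (m : nat) (L M : 'M[R]_m), L^T = L /\ D = LMI_set L M.

(** [complex R] gets its topology and norm as the normed space [C^o] over
    itself. *)
Definition unbounded (D : set C) : Prop := ~ bounded_set (D : set C^o).

Definition closureC (D : set C) : set C := closure (D : set C^o).

Definition recession_cone (D : set C) : set C :=
  [set w | forall (z : C) (t : R), D z -> 0 <= t -> D (z + t%:C * w)].

(** The closed sector with apex 0 around the negative real axis, of inner angle
    [2 * theta0]: a point of modulus [r] at signed angle [phi] from the negative
    real axis is [- r * (cos phi + i sin phi)]. *)
Definition neg_sector (theta0 : R) : set C :=
  [set w | exists r phi : R,
      [/\ 0 <= r, `|phi| <= theta0
        & w = Complex (- (r * cos phi)) (- (r * sin phi))]].

Definition x_max (D : set C) : \bar R :=
  ereal_sup [set x%:E | x in [set x : R | D x%:C]].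

Definition diag_dominant n (alpha theta : R) (A : 'M[R]_n) : Prop :=
  forall i : 'I_n,
    A i i < alpha /\
    \sum_(j < n | j != i) `|A i j| < sin theta * `|A i i - alpha|.

Definition spectrum n (A : 'M[R]_n) : set C :=
  [set z | eigenvalue (complex_mx A) z].

Definition region_stable (D : set C) n (A : 'M[R]_n) : Prop :=
  spectrum A `<=` D.

Definition region_D_stable (D : set C) n (A : 'M[R]_n) : Prop :=
  (closureC D 0 ->
     forall d : 'rV[R]_n, (forall i, 0 < d 0 i) ->
       spectrum (diag_mx d *m A) `<=` D) /\
  (~ closureC D 0 ->
     forall d : 'rV[R]_n, (forall i, 1 <= d 0 i) ->
       spectrum (diag_mx d *m A) `<=` D).

End LMIRegions.

(* Main.v *)
Require Import Defs.
From mathcomp Require Import all_boot all_order all_algebra.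
From mathcomp Require Import all_classical all_reals all_analysis.
From mathcomp Require Import ring lra.

(** Diagonal dominance puts every Gershgorin disc of [A] inside the open sector
    with apex [alpha], of half-angle [theta], around the real half-line to the
    left of [alpha]: a disc centred at distance [c] from the apex on the axis of
    a sector of half-angle [theta] lies in that sector when its radius is at
    most [c * sin theta], the distance from its centre to the boundary ray.

    The region [D] contains such sectors. From every real point [x] of [D], the
    whole sector [x + recession_cone D] stays in [D], and its half-angle
    [theta0] is at least [theta]. The number [x_max D] need not itself be in
    [D], but the dominance inequality is strict, so each disc still fits in the
    sector with apex at some real [x] of [D] close enough to [x_max D]. Hence a
    matrix that is dominant with respect to some [beta <= x_max D] has its
    spectrum in [D] ([diag_dominant_region_stable]).

    Multiplication by a positive diagonal matrix [d] scales each row and so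
    replaces the apex [alpha] by [d_i * alpha] in row [i]; dominance with
    respect to [beta] holds as soon as [beta] bounds all these apexes
    ([diag_dominant_scale_rows]). As [alpha <= 0], one can take [beta = alpha]
    when all [d_i >= 1], and [beta = 0] for arbitrary positive [d_i]. The latter
    requires [0 <= x_max D], which is what [0] being in the closure of [D]
    provides: a point of [D] near [0] is pushed onto the real axis, still near
    [0], along a direction of the recession cone ([closureC0_x_max_ge0]). *)

Set Implicit Arguments.
Unset Strict Implicit.
Unset Printing Implicit Defensive.

Import Order.TTheory GRing.Theory Num.Theory.
Import numFieldNormedType.Exports.

Local Open Scope classical_set_scope.
Local Open Scope ring_scope.

Local Notation "x %:C" := (real_complex _ x).

Lemma eigenvalue_trmx (F : fieldType) (n : nat) (B : 'M[F]_n) (a : F) :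
  eigenvalue B^T a = eigenvalue B a.
Proof.
rewrite !eigenvalue_root_char /char_poly -[in RHS]det_tr; congr (root (\det _) a).
by rewrite /char_poly_mx linearB /= tr_scalar_mx map_trmx.
Qed.

(** In an eigenvector equation, the row of an entry of largest modulus cannot be
    balanced unless the off-diagonal entries of that row make up for
    [a - B i i]. [eigenvalue] speaks of row vectors, so the eigenvector is taken
    for [B^T] in order to get a bound by row sums of [B]. *)
Lemma gershgorin_row_disc (F : numFieldType) (n : nat) (B : 'M[F]_n) (a : F) :
  eigenvalue B a ->
  exists i, `|a - B i i| <= \sum_(j < n | j != i) `|B i j|.
Proof.
rewrite -eigenvalue_trmx => /eigenvalueP[v vB v_neq0].
have [i0 _] : exists i0, v 0 i0 != 0 by apply/rV0Pn.
(* The order of [F] may be partial, but moduli are pairwise comparable. *)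
have [|i _ v_max] := @real_arg_maxP F 'I_n i0 xpredT (fun i => `|v 0 i|) isT.
  by move=> j _; exact: normr_real.
have v_le j : `|v 0 j| <= `|v 0 i| := v_max j isT.
exists i.
have vi_gt0 : 0 < `|v 0 i|.
  rewrite normr_gt0; apply: contraNneq v_neq0 => vi0; apply/eqP/rowP => j.
  by apply/eqP; rewrite mxE -normr_le0 (le_trans (v_le j))// vi0 normr0.
rewrite -(ler_pM2r vi_gt0) -normrM mulr_suml.
have -> : (a - B i i) * v 0 i = \sum_(j < n | j != i) B i j * v 0 j.
  have := congr1 (fun u : 'rV_n => u 0 i) vB; rewrite !mxE (bigD1 i)//= mxE.
  under eq_bigr => j _ do rewrite mxE mulrC.
  by rewrite mulrBl => <-; ring.
apply: le_trans (ler_norm_sum _ _ _) _; apply: ler_sum => j _.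
by rewrite normrM ler_wpM2l// v_le.
Qed.

Section Regions.
Variable R : realType.
Implicit Types (u v c y theta : R) (z : complex R).

(** As [cos] decreases on [[0, pi]], the unsigned angle of [u + i v] is at most
    [theta0] when its cosine [u / |u + i v|] is at least [cos theta0]. Clearing
    the denominator lets the criterion cover the apex and, unlike one on the
    slope [v / u], the vertical rays. *)
Lemma mem_neg_sector theta0 u v : 0 <= theta0 <= pi ->
  cos theta0 * Num.sqrt (u ^+ 2 + v ^+ 2) <= u ->
  neg_sector theta0 (Complex (- u) (- v)).
Proof.
move=> /andP[t0 tpi]; set r := Num.sqrt _ => cos_le.
have r2 : r ^+ 2 = u ^+ 2 + v ^+ 2 by rewrite sqr_sqrtr// addr_ge0// sqr_ge0.
have [r0|r_neq0] := eqVneq r 0.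
  have [u0 v0] : u = 0 /\ v = 0.
    move/eqP: r2; rewrite r0 expr0n/= eq_sym paddr_eq0 ?sqr_ge0//.
    by rewrite !sqrf_eq0 => /andP[/eqP-> /eqP->].
  by exists 0, 0; split; rewrite ?normr0 // u0 v0 !mul0r.
have r_gt0 : 0 < r by rewrite lt_def r_neq0 sqrtr_ge0.
have xB : -1 <= u / r <= 1.
  rewrite ler_pdivrMr// ler_pdivlMr// mulN1r mul1r -ler_norml.
  by rewrite -(@ler_pXn2r _ 2)// ?nnegrE ?(ltW r_gt0)// real_normK ?num_real// r2 lerDl sqr_ge0.
have xI : u / r \in `[-1, 1] by rewrite in_itv.
have rcos : r * cos (acos (u / r)) = u by rewrite acosK// mulrC divfK.
have rsin : r * sin (acos (u / r)) = `|v|.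
  rewrite sin_acos// -[X in X * _](gtr0_norm r_gt0) -sqrtr_sqr -sqrtrM ?sqr_ge0//.
  by rewrite mulrBr mulr1 -exprMn [r * _]mulrC divfK// r2 addrAC subrr add0r sqrtr_sqr.
have acos_le : acos (u / r) <= theta0.
  rewrite leNgt -ltr_cos ?in_itv/= ?acos_ge0 ?acos_lepi ?t0//.
  by rewrite acosK// -leNgt ler_pdivlMr.
have [v_ge0|/ltW v_le0] := leP 0 v.
  exists r, (acos (u / r)); split; rewrite ?(ltW r_gt0)//.
    by rewrite ger0_norm// acos_ge0.
  by rewrite rcos rsin ger0_norm.
exists r, (- acos (u / r)); split; rewrite ?(ltW r_gt0)//.
  by rewrite normrN ger0_norm// acos_ge0.
by rewrite cosN sinN mulrN rcos rsin ler0_norm ?opprK.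
Qed.

(** Seen from the apex, the disc subtends the half-angle whose sine is the radius
    over the distance [c]. With [r = |z|] and [u = - Re z], the disc says
    [r ^+ 2 + c ^+ 2 * cos theta ^+ 2 <= 2 * c * u]; by the arithmetic-geometric
    mean inequality this forces [r * cos theta <= u]. *)
Lemma disc_sub_neg_sector theta0 theta c z :
  0 < theta <= theta0 -> theta0 <= pi / 2 -> 0 < c ->
  `|z + c%:C| <= (c * sin theta)%:C -> neg_sector theta0 z.
Proof.
move=> /andP[t_gt0 t_le] t0_le c_gt0; case: z => p q.
have pi0 := @pi_gt0 R.
rewrite normc_def lecR /= addr0 => dist_le.
have sin_ge0 : 0 <= c * sin theta.
  by rewrite mulr_ge0 ?(ltW c_gt0)// sin_ge0_pi//; lra.
have: (p + c) ^+ 2 + q ^+ 2 <= (c * sin theta) ^+ 2.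
  rewrite -[leLHS]sqr_sqrtr ?addr_ge0 ?sqr_ge0//.
  by rewrite ler_pXn2r// ?nnegrE ?sqrtr_ge0.
rewrite exprMn sin2cos2 => sq_le.
rewrite -[p]opprK -[q]opprK; apply: mem_neg_sector; first lra.
rewrite !sqrrN; set r := Num.sqrt _.
have r2 : r ^+ 2 = p ^+ 2 + q ^+ 2 by rewrite sqr_sqrtr// addr_ge0// sqr_ge0.
have cos_le : cos theta0 <= cos theta.
  rewrite leNgt ltr_cos ?in_itv/= -?leNgt//; lra.
apply: le_trans (ler_wpM2r (sqrtr_ge0 _) cos_le) _; rewrite -/r.
rewrite -(ler_pM2l c_gt0).
have := sqr_ge0 (r - c * cos theta).
nra.
Qed.

(** A boundary direction of the sector with prescribed imaginary part [- y]: it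
    moves a point of ordinate [y] onto the real axis. *)
Lemma neg_sector_boundary theta0 y : 0 < theta0 <= pi / 2 ->
  neg_sector theta0 (Complex (- (`|y| / sin theta0 * cos theta0)) (- y)).
Proof.
move=> /andP[t_gt0 t_le]; have pi0 := @pi_gt0 R.
have s_gt0 : 0 < sin theta0 by apply: sin_gt0_pi; lra.
have r_ge0 : 0 <= `|y| / sin theta0 by rewrite divr_ge0// ltW.
have [y_ge0|/ltW y_le0] := leP 0 y.
  exists (`|y| / sin theta0), theta0; split => //; first by rewrite gtr0_norm.
  by rewrite divfK ?gt_eqF// ger0_norm.
exists (`|y| / sin theta0), (- theta0); split => //.
  by rewrite normrN gtr0_norm.
by rewrite cosN sinN mulrN divfK ?gt_eqF// ler0_norm ?opprK.
Qed.

(** A point [a + i b] of [D] near [0], translated by a boundary direction of the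
    recession cone, gives the real point [a - |b| * cot theta0] of [D], which is
    near [0] because [theta0] is positive. *)
Lemma closureC0_x_max_ge0 (D : set (complex R)) theta0 :
  0 < theta0 <= pi / 2 -> recession_cone D = neg_sector theta0 ->
  Defs.closureC D 0 -> (0%:E <= x_max D)%E.
Proof.
move=> t0B hrc D0; have /andP[t_gt0 t_le] := t0B; have pi0 := @pi_gt0 R.
have s_gt0 : 0 < sin theta0 by apply: sin_gt0_pi; lra.
have cot_ge0 : 0 <= cos theta0 / sin theta0.
  by rewrite divr_ge0 ?(ltW s_gt0)// cos_ge0_pihalf//; lra.
apply/lee_addgt0Pr => e e_gt0.
(* A point within [e / k] of 0 is moved to a real point above [- e]. *)
pose k := 1 + cos theta0 / sin theta0.
have k_gt0 : 0 < k by rewrite /k; lra.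
have dC : 0 < (e / k)%:C :> complex R by rewrite ltcR divr_gt0.
have [[a b] [Dab]] := D0 _ (nbhsx_ballx (0 : (complex R)^o) _ dC).
rewrite -ball_normE /ball_ /= sub0r normrN => near0.
have ab_lt : Num.sqrt (a ^+ 2 + b ^+ 2) < e / k by move: near0; rewrite normc_def ltcR.
have a_le : `|a| <= Num.sqrt (a ^+ 2 + b ^+ 2).
  by rewrite -sqrtr_sqr ler_wsqrtr// lerDl sqr_ge0.
have b_le : `|b| <= Num.sqrt (a ^+ 2 + b ^+ 2).
  by rewrite -sqrtr_sqr ler_wsqrtr// lerDr sqr_ge0.
have := neg_sector_boundary b t0B; rewrite -hrc => /(_ _ 1 Dab ler01).
set w := (X in D X).
pose x := a - `|b| * (cos theta0 / sin theta0).
have -> : w = x%:C.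
  by apply/eqP; rewrite eq_complex /w /x /=; apply/andP; split; apply/eqP; ring.
move=> Dx; have : (x%:E <= x_max D)%E by apply: ereal_sup_ubound; exists x.
move=> /(leeD2r e%:E); apply: le_trans; rewrite -EFinD lee_fin.
have : Num.sqrt (a ^+ 2 + b ^+ 2) * k <= e.
  by rewrite -ler_pdivlMr// ltW.
have := ler_wpM2r cot_ge0 b_le.
have := ler_norm (- a); rewrite normrN /x /k; lra.
Qed.

(** The disc of row [i] has its centre [B i i] on the axis and a radius [s] with
    [B i i + s / sin theta < beta]; any real [x] of [D] beyond
    [B i i + s / sin theta] is the apex of a sector in [D] that contains it. *)
Lemma diag_dominant_region_stable (D : set (complex R)) theta0 theta beta
    (n : nat) (B : 'M[R]_n) :
  0 < theta <= theta0 -> theta0 <= pi / 2 ->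
  recession_cone D = neg_sector theta0 ->
  (beta%:E <= x_max D)%E -> diag_dominant beta theta B -> region_stable D B.
Proof.
move=> tB t0_le hrc beta_le hB z /gershgorin_row_disc[] i.
have pi0 := @pi_gt0 R; have /andP[t_gt0 t_le] := tB.
have s_gt0 : 0 < sin theta by apply: sin_gt0_pi; lra.
rewrite !mxE; under eq_bigr => j _ do rewrite mxE normc_def /= expr0n/= addr0 sqrtr_sqr.
rewrite -rmorph_sum /= => z_near.
have [Bi_lt] := hB i; rewrite ltr0_norm ?subr_lt0// opprB.
move: z_near; set s := \sum_(j < n | _) _ => z_near s_lt.
have s_ge0 : 0 <= s by apply: sumr_ge0.
have : ((B i i + s / sin theta)%:E < x_max D)%E.
  apply: lt_le_trans beta_le; rewrite lte_fin -ltrBrDl ltr_pdivrMr//.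
  by rewrite mulrC.
move=> /ereal_sup_gt[_ [x Dx <-]]; rewrite lte_fin => lt_x.
have s_le : s <= (x - B i i) * sin theta.
  by rewrite -ler_pdivrMr// lerBrDl ltW.
have c_gt0 : 0 < x - B i i.
  by have : 0 <= s / sin theta; [rewrite divr_ge0// ltW | lra].
have : neg_sector theta0 (z - x%:C).
  apply: disc_sub_neg_sector tB t0_le c_gt0 _.
  by rewrite rmorphB /= addrA subrK (le_trans z_near)// lecR.
rewrite -hrc => /(_ _ 1 Dx ler01).
by rewrite rmorph1 mul1r addrC subrK.
Qed.

(** Scaling row [i] by [d_i] scales its centre, its radius and its apex alike; a
    common apex [beta] to the right of all the scaled ones only makes dominance
    easier. *)
Lemma diag_dominant_scale_rows alpha beta theta (n : nat) (A : 'M[R]_n)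
    (d : 'rV[R]_n) :
  0 <= sin theta -> (forall i, 0 < d 0 i) -> (forall i, d 0 i * alpha <= beta) ->
  diag_dominant alpha theta A -> diag_dominant beta theta (diag_mx d *m A).
Proof.
move=> s_ge0 d_gt0 d_alpha hA i; have [Ai_lt sum_lt] := hA i.
have dAi_lt : d 0 i * A i i < beta.
  by rewrite (lt_le_trans _ (d_alpha i))// ltr_pM2l.
rewrite mul_diag_mx !mxE; split => //.
under eq_bigr => j _ do rewrite mxE normrM gtr0_norm//.
rewrite -mulr_sumr ltr0_norm ?subr_lt0// opprB.
move: sum_lt; rewrite ltr0_norm ?subr_lt0// opprB -(ltr_pM2l (d_gt0 i)).
move=> /lt_le_trans; apply; rewrite mulrCA ler_wpM2l// mulrBr.
by rewrite lerD2r.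
Qed.

End Regions.

Theorem theorem4 (R : realType) (D : set (complex R)) (theta0 : R)
    (n : nat) (A : 'M[R]_n) (alpha theta : R)
    (hD : LMI_region D) (hunb : unbounded D)
    (htheta0 : (0 < theta0 <= pi / 2)%R)
    (hrc : recession_cone D = neg_sector theta0)
    (hxmax : (x_max D < +oo)%E)
    (htheta : (0 < theta <= theta0)%R)
    (halpha : (alpha%:E <= Order.min 0%:E (x_max D))%E)
    (hA : diag_dominant alpha theta A) :
  region_stable D A /\ region_D_stable D A.
Proof.
have /andP[_ t0_le] := htheta0; have /andP[t_gt0 t_le] := htheta.
have stable := diag_dominant_region_stable htheta t0_le hrc.
have s_ge0 : 0 <= sin theta.
  by have pi0 := @pi_gt0 R; apply: sin_ge0_pi; lra.
move: halpha; rewrite le_min lee_fin => /andP[alpha_le0 alpha_le].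
split; first exact: stable alpha_le hA.
split=> [D0 d d_gt0|_ d d_ge1].
  apply: (stable 0).
    exact: closureC0_x_max_ge0 htheta0 hrc D0.
  apply: diag_dominant_scale_rows hA => // i.
  by rewrite mulr_ge0_le0// ltW.
apply: stable alpha_le _; apply: diag_dominant_scale_rows hA => // i.
  exact: lt_le_trans (d_ge1 i).
by rewrite ler_neMl.
Qed.
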